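(* There is a constant $C$ such that for every string $w$, $\nu(w)\le C\min(\ell(w),m(w))$; that is, $\nu=O(\min(\ell,m))$.
   Context: NU-system: a tuple $N=(V,R,S,\tau,d,n)$ where $V$ is a finite set of variables, $S\in V^*$ is the axiom, $\tau:V\to V$ is a coding (letter-to-letter, extended letter-wise), $d,n\in\mathbb{N}$, and $R$ assigns to each $A\in V$ a right-hand side $R(A)\in(V\cup E)^+$, where $E=\{A(l)[i,j] : A\in V,\ l,i,j\in\mathbb{N}\}$ is the set of extraction symbols. For a variable $A$ let $A_0=A$ and let $A_{l+1}$ be obtained from $A_l$ by replacing each variable $B$ by $R(B)$, where every extraction symbol $B(l')[i,j]$ in a right-hand side is in turn replaced by the string $\tau(B_{l'}[i,j])\in V^*$ (its $l'$-level expansion, with extractions recursively resolved, restricted to positions $i..j$ and mapped by $\tau$); this replacement counts as a single level. The levels of $N$ are $L_0=S$ and $L_{i+1}$ obtained from $L_i$ in the same way. $A(l)$ abbreviates $A(l)[1,|A_l|]$. $N$ is valid if this recursive resolution has no circular dependencies, so all levels are uniquely determined; it then generates $w[1,n]=\tau(L_d[1,n])$. Its size is $|S|+\sum_{A\in V}|R(A)|$, each extraction symbol counting as one. $\nu(w)$ is the size of the smallest valid NU-system generating $w$. An L-system is a NU-system with no extraction symbols; $\ell(w)$ is the size of the smallest L-system generating $w$. Macro system: a tuple $M=(V,\Sigma,R,S)$ with variables $V$, terminals $\Sigma$ disjoint from $V$, initial variable $S\in V$, and exactly one rule $A\to\alpha$ per variable with $\alpha\in(V\cup\Sigma\cup\{A'[i,j]: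 A'\in V,\ i,j\in\mathbb{N}\})^*$ ($A\to\varepsilon$ allowed only for $A=S$); size $\sum_A |R(A)|$. Expansions: $exp(a)=a$ for terminals, $exp(A)=exp(B_1)\cdots exp(B_k)$ if $A\to B_1\cdots B_k$, $exp(A[i,j])=exp(A)[i,j]$. It is valid if these equations have a single solution $w=exp(S)\in\Sigma^*$, which it then generates; it is internal if every $exp(A)$ is a substring of $w$. $m(w)$ is the size of the smallest valid internal macro system generating $w$. *)

(* Defs.v *)
From mathcomp Require Import all_boot finmap.
From mathcomp Require Import boolp.

Set Implicit Arguments.
Unset Strict Implicit.
Unset Printing Implicit Defensive.

(* Factors are 1-based and inclusive: [factor i j s] is s[i,j], with s[i,j]
   empty when j < i.  When i <= j, s[i,j] is defined only for
   1 <= i <= j <= |s|; [in_range i j s] says that s[i,j] is defined, and the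
   value of [factor] is meaningful only then. *)
Definition factor (A : Type) (i j : nat) (s : seq A) : seq A :=
  drop i.-1 (take j s).

Definition in_range (A : Type) (i j : nat) (s : seq A) : bool :=
  (j < i) || ((0 < i) && (j <= size s)).

(* [NExt B l i j] is the extraction symbol B(l)[i,j]. *)
Inductive nu_symbol (V : Type) : Type :=
| NVar of V
| NExt of V & nat & nat & nat.

Definition is_nvar (V : Type) (x : nu_symbol V) : bool :=
  if x is NVar _ then true else false.

(* The generated string is over an alphabet [T], whose letters may themselves
   be variables: [nu_letter A = Some a] says that the variable [A] is the
   letter [a], and [nu_letter A = None] that [A] is not a letter of [T]. *)
Record nu_system (T : choiceType) := NUSystem {
  nu_var : finType;
  nu_rule : nu_var -> seq (nu_symbol nu_var);
  nu_rule_gt0 : forall A, 0 < size (nu_rule A);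
  nu_axiom : seq nu_var;
  nu_coding : nu_var -> nu_var;
  nu_depth : nat;
  nu_length : nat;
  nu_letter : nu_var -> option T;
  nu_letter_inj : forall A B a,
    nu_letter A = Some a -> nu_letter B = Some a -> A = B
}.

(* In what follows [X A l] stands for the string A_l. *)
Definition nu_resolve (T : choiceType) (N : nu_system T)
    (X : nu_var N -> nat -> seq (nu_var N)) (x : nu_symbol (nu_var N)) :
    seq (nu_var N) :=
  match x with
  | NVar B => [:: B]
  | NExt B l i j => map (@nu_coding T N) (factor i j (X B l))
  end.

Definition nu_expand (T : choiceType) (N : nu_system T)
    (X : nu_var N -> nat -> seq (nu_var N)) (u : seq (nu_symbol (nu_var N))) :
    seq (nu_var N) :=
  flatten (map (nu_resolve X) u).

Definition nu_step (T : choiceType) (N : nu_system T)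
    (X : nu_var N -> nat -> seq (nu_var N)) (s : seq (nu_var N)) :
    seq (nu_var N) :=
  flatten [seq nu_expand X (nu_rule B) | B <- s].

Definition nu_symbol_ok (T : choiceType) (N : nu_system T)
    (X : nu_var N -> nat -> seq (nu_var N)) (x : nu_symbol (nu_var N)) : bool :=
  if x is NExt B l i j then in_range i j (X B l) else true.

Definition nu_solution (T : choiceType) (N : nu_system T)
    (X : nu_var N -> nat -> seq (nu_var N)) : Prop :=
  [/\ forall A, X A 0 = [:: A],
      forall A l, X A l.+1 = nu_step X (X A l)
    & forall A, all (nu_symbol_ok X) (nu_rule A)].

(* [(A, l, p)] is the occurrence at 0-based position [p] of A_l, and
   [nu_needs X y x] says that resolving the occurrence [x] requires [y].
   An occurrence in A_(l+1) lies in the expansion of R(B) for an occurrence of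
   a variable B in A_l.  It requires that occurrence of B and those preceding
   it in A_l (which determine where the expansion of R(B) starts) and, if it
   comes from an extraction symbol C(k)[i,j] of R(B), the extracted occurrence
   in C_k.  The string C_k[i,j] has j+1-i letters, so the place of a symbol
   of R(B) in the expansion requires nothing further. *)
Inductive nu_needs (T : choiceType) (N : nu_system T)
    (X : nu_var N -> nat -> seq (nu_var N)) :
    nu_var N * nat * nat -> nu_var N * nat * nat -> Prop :=
| nu_needs_origin A l s B t r q :
    X A l = s ++ B :: t -> r < size (nu_expand X (nu_rule B)) ->
    q <= size s ->
    nu_needs X (A, l, q) (A, l.+1, size (nu_step X s) + r)
| nu_needs_extraction A l s B t u C k i j v r :
    X A l = s ++ B :: t -> nu_rule B = u ++ NExt C k i j :: v ->
    r < size (nu_resolve X (NExt C k i j)) ->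
    nu_needs X (C, k, i.-1 + r)
      (A, l.+1, size (nu_step X s) + size (nu_expand X u) + r).

(* The levels occurring in rules are bounded, so only finitely many
   occurrences are reachable from a given one: well-foundedness of [nu_needs]
   is the absence of circular dependencies.  Levels are then uniquely
   determined, see [nu_solution_unique]. *)
Definition nu_valid (T : choiceType) (N : nu_system T) : Prop :=
  exists2 X : nu_var N -> nat -> seq (nu_var N),
    nu_solution X & well_founded (nu_needs X).

Definition nu_level (T : choiceType) (N : nu_system T)
    (X : nu_var N -> nat -> seq (nu_var N)) (i : nat) : seq (nu_var N) :=
  iter i (nu_step X) (nu_axiom N).

Definition nu_generates (T : choiceType) (N : nu_system T) (w : seq T) : Prop :=
  exists X : nu_var N -> nat -> seq (nu_var N),
    [/\ nu_solution X,
        in_range 1 (nu_length N) (nu_level X (nu_depth N))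
      & map (@nu_letter T N) (map (@nu_coding T N)
          (factor 1 (nu_length N) (nu_level X (nu_depth N)))) = map Some w].

Definition nu_size (T : choiceType) (N : nu_system T) : nat :=
  size (nu_axiom N) + \sum_(A : nu_var N) size (nu_rule A).

(* Validity is automatic, see [lsystem_valid]. *)
Definition is_lsystem (T : choiceType) (N : nu_system T) : Prop :=
  forall A : nu_var N, all (@is_nvar (nu_var N)) (nu_rule A).

(* [MExt A i j] is A[i,j]. *)
Inductive mac_symbol (V S : Type) : Type :=
| MVar of V
| MTerm of S
| MExt of V & nat & nat.
Arguments MVar {V S}.
Arguments MTerm {V S}.
Arguments MExt {V S}.

Record macro_system (T : choiceType) := MacroSystem {
  mac_var : finType;
  mac_term : {fset T};
  mac_rule : mac_var -> seq (mac_symbol mac_var mac_term);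
  mac_start : mac_var;
  mac_rule_eps : forall A, mac_rule A = [::] -> A = mac_start
}.

Definition mac_resolve (T : choiceType) (M : macro_system T)
    (e : mac_var M -> seq (mac_term M))
    (x : mac_symbol (mac_var M) (mac_term M)) : seq (mac_term M) :=
  match x with
  | MVar B => e B
  | MTerm a => [:: a]
  | MExt B i j => factor i j (e B)
  end.

Definition mac_symbol_ok (T : choiceType) (M : macro_system T)
    (e : mac_var M -> seq (mac_term M))
    (x : mac_symbol (mac_var M) (mac_term M)) : bool :=
  if x is MExt B i j then in_range i j (e B) else true.

Definition mac_solution (T : choiceType) (M : macro_system T)
    (e : mac_var M -> seq (mac_term M)) : Prop :=
  forall A, all (mac_symbol_ok e) (mac_rule A) /\
            e A = flatten (map (mac_resolve e) (mac_rule A)).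

Definition mac_valid (T : choiceType) (M : macro_system T) : Prop :=
  exists2 e : mac_var M -> seq (mac_term M),
    mac_solution e & forall e', mac_solution e' -> e' =1 e.

Definition mac_internal (T : choiceType) (M : macro_system T) : Prop :=
  forall e : mac_var M -> seq (mac_term M), mac_solution e ->
    forall A, infix (e A) (e (mac_start M)).

Definition mac_generates (T : choiceType) (M : macro_system T) (w : seq T) :
    Prop :=
  exists2 e : mac_var M -> seq (mac_term M),
    mac_solution e & map val (e (mac_start M)) = w.

Definition mac_size (T : choiceType) (M : macro_system T) : nat :=
  \sum_(A : mac_var M) size (mac_rule A).

Lemma size_factor (A : Type) i j (s : seq A) :
  in_range i j s -> size (factor i j s) = j.+1 - i.
Proof.
rewrite /in_range /factor size_drop size_take_min; case: i => [|i] //=.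
case/orP => [lt_ji|le_j]; last by rewrite (minn_idPl le_j) subSS.
rewrite subSS; apply/eqP; move: lt_ji; rewrite ltnS => le_ji.
rewrite (_ : j - i = 0); last by apply/eqP.
by rewrite subn_eq0 (leq_trans (geq_minl _ _)).
Qed.

Lemma size_nu_resolve (T : choiceType) (N : nu_system T)
    (X Y : nu_var N -> nat -> seq (nu_var N)) x :
  nu_symbol_ok X x -> nu_symbol_ok Y x ->
  size (nu_resolve X x) = size (nu_resolve Y x).
Proof. by case: x => //= B l i j hX hY; rewrite !size_map !size_factor. Qed.

Lemma size_nu_expand (T : choiceType) (N : nu_system T)
    (X Y : nu_var N -> nat -> seq (nu_var N)) u :
  all (nu_symbol_ok X) u -> all (nu_symbol_ok Y) u ->
  size (nu_expand X u) = size (nu_expand Y u).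
Proof.
elim: u => //= x u IH /andP[hx hu] /andP[hx' hu'].
by rewrite /nu_expand /= !size_cat (size_nu_resolve hx hx') -/(nu_expand X u) IH.
Qed.

Lemma size_nu_step (T : choiceType) (N : nu_system T)
    (X Y : nu_var N -> nat -> seq (nu_var N)) s :
  nu_solution X -> nu_solution Y -> size (nu_step X s) = size (nu_step Y s).
Proof.
move=> [_ _ hX] [_ _ hY]; elim: s => //= B s IH.
rewrite /nu_step /= !size_cat (size_nu_expand (hX B) (hY B)).
by rewrite -/(nu_step X s) IH.
Qed.

Lemma nu_step_cat (T : choiceType) (N : nu_system T)
    (X : nu_var N -> nat -> seq (nu_var N)) s B t :
  nu_step X (s ++ B :: t) =
  nu_step X s ++ nu_expand X (nu_rule B) ++ nu_step X t.
Proof. by rewrite /nu_step map_cat flatten_cat. Qed.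

Lemma nu_expand_cat (T : choiceType) (N : nu_system T)
    (X : nu_var N -> nat -> seq (nu_var N)) u x v :
  nu_expand X (u ++ x :: v) =
  nu_expand X u ++ nu_resolve X x ++ nu_expand X v.
Proof. by rewrite /nu_expand map_cat flatten_cat. Qed.

Lemma flatten_pos (A B : Type) (f : A -> seq B) (s : seq A) p :
  p < size (flatten (map f s)) ->
  exists u x v r, [/\ s = u ++ x :: v, r < size (f x)
                    & p = size (flatten (map f u)) + r].
Proof.
elim: s p => //= x s IH p; rewrite size_cat.
case: (ltnP p (size (f x))) => [lt_p _|le_p].
  by exists [::], x, s, p.
rewrite -ltn_subLR // => /IH[u [y [v [r [-> lt_r def_p]]]]].
exists (x :: u), y, v, r; split=> //=.
by rewrite size_cat -addnA -def_p subnKC.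
Qed.

Lemma onth_prefix (A : Type) (s t : seq A) :
  (forall p, p < size s -> onth t p = onth s p) -> exists t', t = s ++ t'.
Proof.
elim: s t => [|x s IH] [|y t] h; [by exists [::] | by exists (y :: t)
  | by have := h 0 isT | ].
have [[->]] := h 0 isT.
have [p lt_p|t' ->] := IH t; first exact: (h p.+1).
by exists t'.
Qed.

Lemma onth_factor (A : Type) i j (s : seq A) r :
  in_range i j s -> r < size (factor i j s) ->
  i.-1 + r < size s /\ onth (factor i j s) r = onth s (i.-1 + r).
Proof.
move=> ok lt_r; have := lt_r; rewrite size_drop ltn_subRL size_take_min.
rewrite leq_min => /andP[lt_j lt_s]; split=> //.
by rewrite !onthE /factor map_drop map_take nth_drop nth_take.
Qed.

Lemma onth_map (A B : Type) (f : A -> B) s p :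
  onth (map f s) p = omap f (onth s p).
Proof. by elim: s p => [|x s IH] [|p] /=. Qed.

Lemma nu_solution_unique (T : choiceType) (N : nu_system T)
    (X Y : nu_var N -> nat -> seq (nu_var N)) :
  nu_solution X -> well_founded (nu_needs X) -> nu_solution Y ->
  forall A l, Y A l = X A l.
Proof.
move=> hX wf hY; have [X0 XS Xok] := hX; have [Y0 YS Yok] := hY.
have agree (x : nu_var N * nat * nat) :
    x.2 < size (X x.1.1 x.1.2) ->
    onth (Y x.1.1 x.1.2) x.2 = onth (X x.1.1 x.1.2) x.2.
  elim: x / (wf x) => -[[A [|l]] p] _ IH /= lt_p; first by rewrite X0 Y0.
  have := lt_p; rewrite XS => /flatten_pos[s [B [t [o [def_s lt_o def_p]]]]].
  have [u [x [v [r [def_u lt_r def_o]]]]] := flatten_pos lt_o.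
  have [t' def_t'] : exists t', Y A l = (s ++ [:: B]) ++ t'.
    apply: onth_prefix => q; rewrite size_cat addn1 ltnS => le_q.
    have lt_q : q < size (X A l).
      by rewrite def_s size_cat /= addnS ltnS (leq_trans le_q) ?leq_addr.
    rewrite -[LHS]/(onth (Y (A, l, q).1.1 (A, l, q).1.2) (A, l, q).2) IH //=.
      rewrite def_s -cat_rcons -cats1 [in LHS]onth_cat.
      by rewrite size_cat addn1 ltnS le_q.
    by rewrite def_p; apply: nu_needs_origin def_s _ _.
  have locate (Z : nu_var N -> nat -> seq (nu_var N)) t1 : nu_solution Z ->
      Z A l = s ++ B :: t1 -> onth (Z A l.+1) p = onth (nu_resolve Z x) r.
    move=> hZ def_Z; have [_ ZS Zok] := hZ.
    have := Xok B; have := Zok B; rewrite def_u !all_cat /=.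
    move=> /and3P[okZu okZx okZv] /and3P[okXu okXx okXv].
    rewrite ZS def_Z nu_step_cat def_u nu_expand_cat def_p def_o.
    rewrite -/(nu_step X s) -/(nu_expand X u).
    rewrite (size_nu_step s hX hZ) (size_nu_expand okXu okZu).
    rewrite onth_cat ltnNge leq_addr /= addKn -!catA.
    rewrite onth_cat ltnNge leq_addr /= addKn.
    by rewrite onth_cat -(size_nu_resolve okXx okZx) lt_r.
  rewrite (locate Y t') //; last by rewrite def_t' -catA.
  rewrite -XS (locate X t) //.
  have := Xok B; have := Yok B; rewrite def_u !all_cat /=.
  move=> /and3P[_ okYx _] /and3P[_ okXx _].
  case: x def_u lt_r {locate} okXx okYx => //= C k i j def_u lt_r okX okY.
  have lt_rX := lt_r; rewrite size_map in lt_rX.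
  have lt_rY : r < size (factor i j (Y C k)).
    by rewrite size_factor // -(size_factor okX).
  have [lt_ir eqX] := onth_factor okX lt_rX.
  have [_ eqY] := onth_factor okY lt_rY.
  rewrite !onth_map eqX eqY; congr omap.
  apply: (IH (C, k, i.-1 + r)) => //.
  rewrite def_p def_o addnA; exact: nu_needs_extraction def_s def_u lt_r.
move=> A; elim=> [|l IH]; first by rewrite X0 Y0.
have eq_size : size (Y A l.+1) = size (X A l.+1).
  by rewrite XS YS IH (size_nu_step _ hX hY).
have [p /(agree (A, l.+1, p))|t def_Y] := @onth_prefix _ (X A l.+1) (Y A l.+1).
  by [].
move: eq_size; rewrite def_Y size_cat -[RHS]addn0 => /addnI/size0nil->.
by rewrite cats0.
Qed.

Lemma lsystem_expand (T : choiceType) (N : nu_system T)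
    (X Y : nu_var N -> nat -> seq (nu_var N)) B :
  is_lsystem N -> nu_expand X (nu_rule B) = nu_expand Y (nu_rule B).
Proof.
move=> /(_ B); rewrite /nu_expand.
by elim: (nu_rule B) => //= -[C|//] u IH /= /IH ->.
Qed.

Lemma lsystem_step (T : choiceType) (N : nu_system T)
    (X Y : nu_var N -> nat -> seq (nu_var N)) s :
  is_lsystem N -> nu_step X s = nu_step Y s.
Proof.
move=> lN; rewrite /nu_step; congr flatten; apply: eq_map => B.
exact: lsystem_expand.
Qed.

Lemma lsystem_solution (T : choiceType) (N : nu_system T) :
  is_lsystem N -> exists X : nu_var N -> nat -> seq (nu_var N), nu_solution X.
Proof.
move=> lN; exists (fun A l => iter l (nu_step (fun _ _ => [::])) [:: A]).
split=> // [A l|A]; first by rewrite iterS; exact: lsystem_step.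
by apply: sub_all (lN A) => -[].
Qed.

Lemma lsystem_valid (T : choiceType) (N : nu_system T) :
  is_lsystem N -> nu_valid N.
Proof.
move=> lN; have [X hX] := lsystem_solution lN; exists X; first exact: hX.
have dep x y : nu_needs X y x -> x.1.2 = y.1.2.+1.
  case=> [//|A l s B t u C k i j v r _ defR _].
  by have := lN B; rewrite defR all_cat /= andbF.
move=> x; have [l] := ubnP x.1.2; elim: l x => [x|l IH x lt_x]; first by rewrite ltn0.
constructor=> y /dep def_x; apply: IH; by rewrite def_x in lt_x.
Qed.

Definition nu_size_of (T : choiceType) (w : seq T) (k : nat) : Prop :=
  exists N : nu_system T, [/\ nu_valid N, nu_generates N w & nu_size N = k].

Definition lsystem_size_of (T : choiceType) (w : seq T) (k : nat) : Prop :=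
  exists N : nu_system T, [/\ is_lsystem N, nu_generates N w & nu_size N = k].

Definition mac_size_of (T : choiceType) (w : seq T) (k : nat) : Prop :=
  exists M : macro_system T,
    [/\ mac_valid M, mac_internal M, mac_generates M w & mac_size M = k].

Lemma fset_word (T : choiceType) (w : seq T) :
  exists (D : {fset T}) (u : seq D), map val u = w.
Proof.
exists [fset x in w]%fset; exists (pmap insub w); rewrite (pmap_filter (@insubK _ _ _)).
by apply/all_filterP/allP => x w_x; rewrite isSome_insub inE.
Qed.

Lemma lsystem_size_exists (T : choiceType) (w : seq T) :
  exists k, `[< lsystem_size_of w k >].
Proof.
have [D [u def_w]] := fset_word w.
have letter_inj (A B : D) (a : T) :
  Some (val A) = Some a -> Some (val B) = Some a -> A = B.
  by move=> [eA] [eB]; apply: val_inj; rewrite /= eA eB.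
pose N := @NUSystem T D (fun A => [:: NVar A]) (fun=> isT) u id 0 (size u)
            (fun A => Some (val A)) letter_inj.
have lN : is_lsystem N by [].
have [X hX] := lsystem_solution lN.
exists (nu_size N); apply/asboolP; exists N; split=> //.
exists X; split=> //; first by rewrite /in_range /= leqnn orbT.
by rewrite /nu_level /= /factor drop0 take_size map_id -def_w -map_comp.
Qed.

Lemma nu_size_exists (T : choiceType) (w : seq T) :
  exists k, `[< nu_size_of w k >].
Proof.
have [k /asboolP[N [lN genN sizeN]]] := lsystem_size_exists w.
by exists k; apply/asboolP; exists N; split=> //; apply: lsystem_valid.
Qed.

Lemma mac_size_exists (T : choiceType) (w : seq T) :
  exists k, `[< mac_size_of w k >].
Proof.
have [D [u def_w]] := fset_word w.
have eps (A : unit) : map (@MTerm unit _) u = [::] -> A = tt by case: A.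
pose M := @MacroSystem T unit D (fun=> map MTerm u) tt eps.
have flat (e : mac_var M -> seq (mac_term M)) :
    flatten (map (mac_resolve e) (map MTerm u)) = u.
  by rewrite -map_comp flatten_seq1.
have solM : mac_solution (M := M) (fun=> u).
  by move=> A; rewrite flat; split=> //; rewrite all_map; apply/allP.
exists (mac_size M); apply/asboolP; exists M; split=> //.
- by exists (fun=> u) => // e sol_e A; have [_ ->] := sol_e A; rewrite flat.
- by move=> e sol_e A; case: A; apply: infix_refl.
- by exists (fun=> u).
Qed.

Definition nu_measure (T : choiceType) (w : seq T) : nat :=
  ex_minn (nu_size_exists w).

Definition lsystem_measure (T : choiceType) (w : seq T) : nat :=
  ex_minn (lsystem_size_exists w).

Definition mac_measure (T : choiceType) (w : seq T) : nat :=
  ex_minn (mac_size_exists w).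

(* Main.v *)
Require Import Defs.
From mathcomp Require Import all_boot.
From mathcomp Require Import finmap boolp.

Set Implicit Arguments.
Unset Strict Implicit.
Unset Printing Implicit Defensive.

(** An L-system is a NU-system.  A macro system is turned into a NU-system of
    depth 1 by reading [A[i,j]] as [A(1)[i,j]] and making terminals fixed
    points.  What has to be checked is that no position depends on itself.  The
    positions whose letter is not traced back to a terminal could all be filled
    with one arbitrary letter, so over at least two terminals uniqueness of the
    solution leaves no such position.  Over a single terminal a valid macro
    system may be circular, as [A -> A[1,1]] is, but then the word is unary and
    a prefix of a level of [A -> AA]. *)

(** * Factors, ranges and lists *)

Lemma map_factor (A B : Type) (f : A -> B) i j s :
  map f (factor i j s) = factor i j (map f s).
Proof. by rewrite /factor map_drop map_take. Qed.

Lemma in_range_size (A B : Type) i j (s : seq A) (t : seq B) :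
  size s = size t -> in_range i j s = in_range i j t.
Proof. by rewrite /in_range => ->. Qed.

Lemma factor_all (A : Type) (s : seq A) : factor 1 (size s) s = s.
Proof. by rewrite /factor drop0 take_size. Qed.

Lemma in_range_all (A : Type) (s : seq A) : in_range 1 (size s) s.
Proof. by rewrite /in_range /= leqnn orbT. Qed.

Lemma map_eq_cat_cons (A B : Type) (f : A -> B) s u y v :
  map f s = u ++ y :: v ->
  exists u' x v', [/\ s = u' ++ x :: v', u = map f u' & y = f x].
Proof.
elim: s u => [|x s IH] [|z u] //= [def_y].
  by move=> _; exists [::], x, s; rewrite def_y.
by case/IH=> u' [x' [v' [-> -> ->]]]; exists (x :: u'), x', v'; rewrite -def_y.
Qed.

(** * Upper bounds on [nu_measure] by L-systems *)

Lemma nu_measure_le (T : choiceType) (N : nu_system T) (w : seq T) :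
  nu_valid N -> nu_generates N w -> nu_measure w <= nu_size N.
Proof.
move=> validN genN; rewrite /nu_measure; case: ex_minnP => k _; apply.
by apply/asboolP; exists N.
Qed.

Lemma nu_measure_le_lsystem (T : choiceType) (w : seq T) :
  nu_measure w <= lsystem_measure w.
Proof.
rewrite /lsystem_measure; case: ex_minnP => k /asboolP[N [lN genN <-]] _.
exact: nu_measure_le (lsystem_valid lN) genN.
Qed.

(** A macro system with an empty start rule can have size 0, so the empty word leaves no room for an
    additive constant. *)
Lemma nu_measure_nil (T : choiceType) : nu_measure ([::] : seq T) = 0.
Proof.
have gt0 (A : void) : 0 < size ([::] : seq (nu_symbol void)) by case: A.
have inj (A B : void) (a : T) : None = Some a -> None = Some a -> A = B by [].
pose N := @NUSystem T void (fun=> [::]) gt0 [::] id 0 0 (fun=> None) inj.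
have lN : is_lsystem N by case.
have [X solX] := lsystem_solution lN.
have /(nu_measure_le (lsystem_valid lN)) : nu_generates N [::] by exists X.
by rewrite /nu_size big_pred0 ?leqn0 => [/eqP|[]].
Qed.

Lemma nu_measure_nseq (T : choiceType) n (a : T) : nu_measure (nseq n a) <= 3.
Proof.
have inj (A B : unit) (b : T) : Some a = Some b -> Some a = Some b -> A = B.
  by case: A B => [] [].
(* Depth [n] suffices for the prefix of length [n], because the level has length [2 ^ n]; the depth
   does not count towards the size. *)
pose N := @NUSystem T unit (fun=> [:: NVar tt; NVar tt]) (fun=> isT) [:: tt] id
            n n (fun=> Some a) inj.
have lN : is_lsystem N by [].
have [X solX] := lsystem_solution lN.
have size_step s : size (nu_step (N := N) X s) = (size s).*2.
  elim: s => //= A s; rewrite /nu_step /= => ->; by rewrite doubleS.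
have size_level i : size (nu_level (N := N) X i) = 2 ^ i.
  by elim: i => //= i IH; rewrite size_step IH expnS mul2n.
suff /(nu_measure_le (lsystem_valid lN)) : nu_generates N (nseq n a).
  move=> le_N; apply: leq_trans le_N _.
  by rewrite /nu_size /= sum_nat_const card_unit.
have range : in_range 1 n (nu_level (N := N) X n).
  by rewrite /in_range size_level (ltnW (ltn_expl n _)) ?orbT.
have map_const (s : seq unit) : [seq Some a | _ <- s] = nseq (size s) (Some a).
  by elim: s => //= b s ->.
exists X; split=> //; rewrite map_nseq -map_comp.
by rewrite [LHS]map_const size_factor // subn1.
Qed.

(** * Where the letters of a macro solution are copied from *)

Section Origins.

Variables (T : choiceType) (M : macro_system T).
Variable e : mac_var M -> seq (mac_term M).
Hypothesis sol_e : mac_solution e.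

Local Notation V := (mac_var M).
Local Notation Sigma := (mac_term M).
Implicit Types (A B : V) (x : mac_symbol V Sigma) (lam : V * nat -> Sigma).

Definition positions A : seq (Sigma + V * nat) :=
  [seq inr (A, p) | p <- iota 0 (size (e A))].

Definition symbol_origins x : seq (Sigma + V * nat) :=
  match x with
  | MVar B => positions B
  | MTerm a => [:: inl a]
  | MExt B i j => factor i j (positions B)
  end.

(** A symbolic expansion of the rule of [A]: each place holds either a terminal written there
    ([inl]) or the position it copies ([inr]). *)
Definition origins A := flatten (map symbol_origins (mac_rule A)).

(* [refers y x]: the letter at the position [x] is copied from [y]. *)
Definition refers (y x : V * nat) := onth (origins x.1) x.2 = Some (inr y).

Definition origin_label lam (o : Sigma + V * nat) : Sigma :=
  match o with inl a => a | inr y => lam y end.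

Definition relabel lam A := [seq lam (A, p) | p <- iota 0 (size (e A))].

Lemma size_positions A : size (positions A) = size (e A).
Proof. by rewrite size_map size_iota. Qed.

Lemma size_relabel lam A : size (relabel lam A) = size (e A).
Proof. by rewrite size_map size_iota. Qed.

Lemma onth_positions A p :
  p < size (e A) -> onth (positions A) p = Some (inr (A, p)).
Proof.
move=> lt_p; rewrite onth_map onthE (nth_map 0) ?size_iota //.
by rewrite nth_iota.
Qed.

(** Concatenation and extraction move positions without looking at the letters, so they commute with
    any relabelling. *)
Lemma resolve_relabel lam s :
  flatten (map (mac_resolve (relabel lam)) s) =
  map (origin_label lam) (flatten (map symbol_origins s)).
Proof.
rewrite map_flatten -map_comp; congr flatten; apply: eq_map.
by case=> [B|a|B i j] //=; rewrite ?map_factor -map_comp.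
Qed.

Lemma relabel_nth c : relabel (fun y => nth c (e y.1) y.2) =1 e.
Proof. by move=> A; apply: mkseq_nth. Qed.

Lemma size_symbol_origins (s : seq (mac_symbol V Sigma)) :
  size (flatten (map symbol_origins s)) =
  size (flatten (map (mac_resolve e) s)).
Proof.
elim: s => //= x s; rewrite !size_cat => ->; congr addn.
case: x => [B|a|B i j] //=; first exact: size_positions.
by rewrite /factor !size_drop !size_take_min size_positions.
Qed.

Lemma size_origins A : size (origins A) = size (e A).
Proof. by rewrite size_symbol_origins; have [_ <-] := sol_e A. Qed.

Lemma origins_nth c A p :
  p < size (e A) ->
  exists2 o, onth (origins A) p = Some o
    & nth c (e A) p = origin_label (fun y => nth c (e y.1) y.2) o.
Proof.
pose lam (y : V * nat) := nth c (e y.1) y.2; rewrite -/lam => lt_p.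
have [_ def_e] := sol_e A.
have {}def_e : e A = map (origin_label lam) (origins A).
  rewrite -resolve_relabel [LHS]def_e; congr flatten; apply: eq_map.
  by case=> [B|a|B i j] //=; rewrite relabel_nth.
have lt_o : p < size (origins A) by rewrite size_origins.
exists (nth (inl c) (origins A) p); last by rewrite {1}def_e (nth_map (inl c)).
by rewrite onthE (nth_map (inl c)).
Qed.

(** The lengths are those of [e] and hence already right; what remains is one local equation per
    position. *)
Lemma relabel_solution lam :
  (forall A p o, onth (origins A) p = Some o ->
     lam (A, p) = origin_label lam o) ->
  mac_solution (relabel lam).
Proof.
move=> lamP A; have [ok_e _] := sol_e A; split.
  apply: sub_all ok_e => -[B|a|B i j] //=.
  by rewrite (in_range_size _ _ (size_relabel lam B)).
rewrite resolve_relabel -/(origins A).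
have [sz0|_] := posnP (size (e A)).
  by rewrite /relabel sz0 (size0nil (etrans (size_origins A) sz0)).
(* [Sigma] might be empty, so the default letter for [nth] is taken from a nonempty [e A]. *)
pose c := lam (A, 0).
apply: (@eq_from_nth _ c) => [|p]; rewrite size_relabel.
  by rewrite size_map size_origins.
move=> lt_p; have lt_o : p < size (origins A) by rewrite size_origins.
rewrite (nth_map 0) ?size_iota // nth_iota // add0n (nth_map (inl c)) //.
by apply: lamP; rewrite onthE (nth_map (inl c)).
Qed.

(** Keeping [e] on the accessible positions and writing a constant on all others gives a solution.
    The constants [c1] and [c2] would give two different ones if some position were inaccessible. *)
Lemma refers_wf (c1 c2 : Sigma) :
  (forall e', mac_solution e' -> e' =1 e) -> c1 <> c2 -> well_founded refers.
Proof.
move=> uniq_e neq_c.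
pose lam c (y : V * nat) :=
  if `[< Acc refers y >] then nth c1 (e y.1) y.2 else c.
have sol_lam c : mac_solution (relabel (lam c)).
  apply: relabel_solution => A p o def_o.
  have lt_p : p < size (e A).
    by rewrite -size_origins -[_ < _](onthTE (origins A)) def_o.
  have [o' def_o' def_nth] := origins_nth c1 lt_p.
  move: def_o'; rewrite def_o => -[eq_o]; rewrite -{o'}eq_o in def_nth.
  case: o def_o def_nth => [a|y] def_o def_nth.
    have acc_x : Acc refers (A, p).
      by constructor=> y; rewrite /refers [in X in X -> _]/= def_o.
    by rewrite /lam (asboolT acc_x).
  (* A position refers to at most one other, so accessibility passes in both directions. *)
  have accE : Acc refers (A, p) <-> Acc refers y.
    split=> [[acc_x]|acc_y]; first exact: acc_x.
    by constructor=> z; rewrite /refers /= def_o => -[<-].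
  rewrite /= /lam; have -> : `[< Acc refers (A, p) >] = `[< Acc refers y >].
    exact: asbool_equiv_eq.
  by case: asboolP => // _; exact: def_nth.
(* Positions beyond the end of [e A] have no origin and are trivially accessible. *)
case=> A p; case: (ltnP p (size (e A))) => [lt_p|le_p]; last first.
  constructor=> y; rewrite /refers /= => def_y.
  have := onthTE (origins A) p; rewrite def_y size_origins => /esym.
  by rewrite ltnNge le_p.
apply: contrapT => not_acc; apply: neq_c.
have value c : nth c1 (relabel (lam c) A) p = c.
  by rewrite (nth_map 0) ?size_iota // nth_iota // /lam asboolF.
by rewrite -(value c1) -(value c2) !(uniq_e _ (sol_lam _)).
Qed.

(** * Terminals written in rules *)

Definition as_term x : option Sigma := if x is MTerm a then Some a else None.

(** Each letter of the NU-system costs one rule, and the declared alphabet may be larger than the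
    macro system; only these terminals become letters. *)
Definition used_terms : seq Sigma :=
  flatten [seq pmap as_term (mac_rule A) | A <- enum V].

Lemma size_used_terms : size used_terms <= mac_size M.
Proof.
rewrite size_flatten /shape -map_comp sumnE big_map big_enum /=.
by apply: leq_sum => A _; rewrite size_pmap count_size.
Qed.

Definition origin_ok (o : Sigma + V * nat) : bool :=
  match o with inl a => a \in used_terms | inr y => y.2 < size (e y.1) end.

Lemma origins_ok A : all origin_ok (origins A).
Proof.
have positions_ok B : all origin_ok (positions B).
  by rewrite all_map; apply/allP => p; rewrite mem_iota.
have : {subset pmap as_term (mac_rule A) <= used_terms}.
  move=> a A_a; apply/flattenP; exists (pmap as_term (mac_rule A)) => //.
  by apply: map_f; rewrite mem_enum.
rewrite /origins; elim: (mac_rule A) => //= x s IH sub_used; rewrite all_cat.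
apply/andP; split; last first.
  apply: IH => a s_a; apply: sub_used.
  by case: x => [B|b|B i j] //=; rewrite inE s_a orbT.
case: x sub_used => [B|b|B i j] //= sub_used.
  by rewrite sub_used ?mem_head.
by apply/allP => o /mem_drop/mem_take; apply/allP.
Qed.

Lemma onth_origins_ok A p o : onth (origins A) p = Some o -> origin_ok o.
Proof.
by move=> def_o; apply: (allP (origins_ok A)); apply/onthP; exists p.
Qed.

(** Following references from an occurrence of [a] must stop, and it can only stop at a terminal
    written in a rule. *)
Lemma solution_used A a : well_founded refers -> a \in e A -> a \in used_terms.
Proof.
move=> wf e_a; have lt_p : index a (e A) < size (e A) by rewrite index_mem.
rewrite -(nth_index a e_a); move: lt_p; move: (index a (e A)) => p {e_a}.
pose x := (A, p); rewrite -[A]/x.1 -[p]/x.2.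
elim: x / (wf x) => -[B q] _ IH /= lt_q.
have [[b|y] def_o ->] := origins_nth a lt_q; first exact: onth_origins_ok def_o.
by apply: IH; [exact: def_o | exact: onth_origins_ok def_o].
Qed.

(** * The NU-system of a macro system *)

Section Translation.

Hypothesis rule_gt0 : forall A, 0 < size (mac_rule A).

Local Notation letter := {a : Sigma | a \in used_terms}.
Local Notation W := (V + letter)%type.

(* A terminal that no rule mentions is sent to an irrelevant variable. *)
Definition letter_var (a : Sigma) : W :=
  if insub a is Some u then inr u else inl (mac_start M).

(** A plain variable [B] becomes a full extraction: as an [NVar] it would stay unexpanded at level
    1. *)
Definition tr_symbol x : nu_symbol W :=
  match x with
  | MVar B => NExt (inl B) 1 1 (size (e B))
  | MTerm a => NVar (letter_var a)
  | MExt B i j => NExt (inl B) 1 i j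
  end.

Definition tr_rule (D : W) : seq (nu_symbol W) :=
  match D with
  | inl A => map tr_symbol (mac_rule A)
  | inr u => [:: NVar (inr u)]
  end.

Lemma tr_rule_gt0 D : 0 < size (tr_rule D).
Proof. by case: D => [A|u] //=; rewrite size_map. Qed.

Definition var_letter (D : W) : option T :=
  if D is inr u then Some (val (val u)) else None.

Lemma var_letter_inj D1 D2 a :
  var_letter D1 = Some a -> var_letter D2 = Some a -> D1 = D2.
Proof.
case: D1 D2 => [//|u] [//|v] [eq_u] [eq_v].
by congr inr; do 2!apply: val_inj; rewrite /= eq_u eq_v.
Qed.

Definition tr_system : nu_system T :=
  @NUSystem T W tr_rule tr_rule_gt0 [:: inl (mac_start M)] id 1
    (size (e (mac_start M))) var_letter var_letter_inj.

(** The levels in closed form: letters are fixed points, so nothing changes after level 1. *)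
Definition tr_level (D : nu_var tr_system) (l : nat) : seq (nu_var tr_system) :=
  match D, l with
  | inl A, _.+1 => map letter_var (e A)
  | _, _ => [:: D]
  end.

Lemma tr_expand s :
  nu_expand tr_level (map tr_symbol s) =
  map letter_var (flatten (map (mac_resolve e) s)).
Proof.
rewrite /nu_expand map_flatten -!map_comp; congr flatten; apply: eq_map.
case=> [B|a|B i j] //=; rewrite map_id ?map_factor //.
by rewrite -(size_map letter_var (e B)) factor_all.
Qed.

Lemma tr_expand_rule A :
  nu_expand tr_level (nu_rule (n := tr_system) (inl A)) = map letter_var (e A).
Proof. by rewrite tr_expand; have [_ <-] := sol_e A. Qed.

Lemma letter_var_used a : a \in used_terms ->
  exists2 u : letter, letter_var a = inr u & val u = a.
Proof. by move=> used_a; rewrite /letter_var insubT; exists (Sub a used_a). Qed.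

(** The axiom contributes 1, the translated rules [mac_size M], and the one-symbol rules of the
    letters at most [mac_size M]. *)
Lemma nu_size_tr : nu_size tr_system <= 1 + 2 * mac_size M.
Proof.
rewrite /nu_size leq_add2l big_sumType /= mul2n -addnn.
under eq_bigr => A _ do rewrite size_map.
rewrite leq_add2l sum_nat_const muln1 card_sig.
exact: leq_trans (card_size _) size_used_terms.
Qed.

Hypothesis wf_refers : well_founded refers.

Lemma tr_solution : nu_solution tr_level.
Proof.
split=> [[]//|D l|[A|u] //].
  case: D => [A|u]; last by case: l.
  case: l => [|l] /=; first by rewrite /nu_step /= cats0 tr_expand_rule.
  have : {subset e A <= used_terms} by move=> a; apply: solution_used.
  rewrite /nu_step; elim: (e A) => //= a s IH sub_used.
  rewrite -IH => [|b s_b]; last by apply: sub_used; rewrite inE s_b orbT.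
  by have [u -> _] := letter_var_used (sub_used a (mem_head _ _)).
have [ok_e _] := sol_e A; rewrite all_map; apply: sub_all ok_e.
case=> [B|a|B i j] //= => [_|].
  by rewrite -(size_map letter_var (e B)) in_range_all.
by rewrite (in_range_size _ _ (size_map letter_var (e B))).
Qed.

Lemma tr_needs (o' o : nu_var tr_system * nat * nat) : nu_needs tr_level o' o ->
  exists2 l, o.1.2 = l.+1
    & o'.1 = (o.1.1, l) \/
      exists A B q,
        [/\ o.1 = (inl A, 1), o' = (inl B, 1, q) & refers (B, q) (A, o.2)].
Proof.
case=> [D l s F t r q _ _ _|D l s F t u G k i j v r def_s def_u lt_r] /=.
  by exists l => //; left.
(* Rules of letters contain no extraction, so [F] is a macro variable; such variables occur only at
   level 0, as later levels consist of letters. *)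
exists l => //; right; case: F def_s def_u => [A|a] def_s def_u; last first.
  by case: u def_u => [|? []] //.
have [eq_D eq_l eq_s] : [/\ D = inl A, l = 0 & s = [::]].
  move: def_s; case: D l => [A'|a] [|l] /=; try by case: s => [|? []] // [].
  - by case: s => [|? []] // [->].
  - move=> def_s; have [s' [a [t' [def_e _ def_a]]]] := map_eq_cat_cons def_s.
    have used_a : a \in used_terms.
      by apply: (@solution_used A'); rewrite // def_e mem_cat mem_head orbT.
    by have [b eq_b _] := letter_var_used used_a; rewrite eq_b in def_a.
have [u' [x [v' [def_rule -> def_x]]]] := map_eq_cat_cons def_u.
rewrite eq_D eq_l eq_s /= {def_s eq_D eq_l eq_s}.
(* The symbols before [x] fill equally many places in the expansion and in [origins A], so the
   offset [r] marks the same place in both. *)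
have szE : size (nu_expand tr_level (map tr_symbol u')) =
    size (flatten (map symbol_origins u')).
  by rewrite tr_expand size_map size_symbol_origins.
rewrite add0n szE.
have onth_x : onth (origins A) (size (flatten (map symbol_origins u')) + r) =
    onth (symbol_origins x ++ flatten (map symbol_origins v')) r.
  rewrite /origins def_rule map_cat flatten_cat onth_cat ltnNge leq_addr /=.
  by rewrite addKn.
rewrite size_map in lt_r.
case: x def_rule def_x onth_x => [B|b|B i' j'] //= def_rule.
all: move=> [eG ek ei ej] onth_x.
  subst G k i j; rewrite /= -(size_map letter_var) factor_all size_map in lt_r.
  exists A, B, r; split=> //; rewrite /refers onth_x onth_cat size_positions.
  by rewrite lt_r onth_positions.
subst G k i' j'; exists A, B, (i.-1 + r); split=> //.
have ok : in_range i j (positions B).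
  rewrite (in_range_size _ _ (size_positions B)).
  by have [] := sol_e A; rewrite def_rule all_cat /= => /and3P[].
have lt_f : r < size (factor i j (positions B)).
  move: lt_r; rewrite !size_factor //.
  rewrite (in_range_size _ _ (size_map _ _)).
  by rewrite -(in_range_size _ _ (size_positions B)).
have [lt_p def_p] := onth_factor ok lt_f.
rewrite /refers onth_x onth_cat lt_f def_p onth_positions //.
by rewrite -size_positions.
Qed.

(** Induction on the level, and within level 1 along [refers]. *)
Lemma tr_valid : nu_valid tr_system.
Proof.
exists tr_level; first exact: tr_solution.
suff acc l D q : Acc (nu_needs tr_level) (D, l, q) by case=> -[D l] q.
elim: l D q => [|l IH] D q; first by constructor=> y /tr_needs[].
(* A dependency that does not lower the level is a reference within level 1, hence the premise
   [l = 0]. *)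
have step A p : (forall B q', l = 0 -> refers (B, q') (A, p) ->
      Acc (nu_needs tr_level) (inl B, 1, q')) ->
    Acc (nu_needs tr_level) (inl A, l.+1, p).
  move=> IHp; constructor=> -[[E k] r] /tr_needs[_ [<-] /= []] => [[-> ->]|].
    exact: IH.
  by case=> A' [B [q' [[<- eq_l] [-> -> ->] /IHp]]]; apply.
case: D => [A|a].
  rewrite -[A]/(A, q).1 -[q]/(A, q).2; elim: (A, q) / (wf_refers (A, q)).
  by move=> [A' q'] _ IHq; apply: step => B p l0 /IHq /=; rewrite l0.
constructor=> -[[E k] r] /tr_needs[_ [<-] /= []] => [[-> ->]|]; first exact: IH.
by case=> ? [? [? []]].
Qed.

Lemma tr_generates : nu_generates tr_system (map val (e (mac_start M))).
Proof.
exists tr_level; rewrite /nu_level /= /nu_step /= cats0 tr_expand_rule.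
rewrite -(size_map letter_var) in_range_all factor_all map_id.
split=> //; first exact: tr_solution.
rewrite -!map_comp; apply/eq_in_map => a /(solution_used wf_refers).
by case/letter_var_used=> u /= -> <-.
Qed.

End Translation.

End Origins.

(** * Comparison of the measures *)

Lemma nu_measure_le_mac (T : choiceType) (w : seq T) :
  nu_measure w <= 3 * mac_measure w.
Proof.
rewrite /mac_measure; case: ex_minnP => k /asboolP[M [validM _ genM <-]] _.
have [e sol_e uniq_e] := validM; have [e' sol_e' def_w] := genM.
have {e' sol_e'} def_w : map val (e (mac_start M)) = w.
  by rewrite -def_w (uniq_e _ sol_e').
case: w => [|c w] in def_w genM *; first by rewrite nu_measure_nil.
have start_gt0 : 0 < size (mac_rule (mac_start M)).
  have [_] := sol_e (mac_start M).
  by case: (mac_rule _) => // def_e; rewrite def_e in def_w.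
(* Only the start variable may have an empty rule, and here its rule is nonempty because the word
   is. *)
have rule_gt0 (A : mac_var M) : 0 < size (mac_rule A).
  by case def_A: (mac_rule A) => //; rewrite -def_A (mac_rule_eps def_A).
have M_gt0 : 0 < mac_size M.
  by rewrite /mac_size (bigD1 (mac_start M)) //= addn_gt0 start_gt0.
have [[c1 [c2 neq_c]]|unary] := pselect (exists c1 c2 : mac_term M, c1 <> c2).
  have wf := refers_wf sol_e uniq_e neq_c.
  have valid := tr_valid sol_e rule_gt0 wf.
  rewrite -def_w; apply: leq_trans (nu_measure_le valid _) _.
    exact: tr_generates.
  (* The additive 1 is absorbed by [mac_size M], which is positive. *)
  by apply: leq_trans (nu_size_tr _ _) _; rewrite [3 * _]mulSn leq_add2r.
have -> : c :: w = nseq (size (c :: w)) c.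
  apply/all_pred1P; apply/allP => a; rewrite -def_w => /mapP[u _ ->].
  have : c \in map val (e (mac_start M)) by rewrite def_w mem_head.
  case/mapP=> v _ ->; apply/eqP; congr val; apply: contrapT => neq_uv.
  by apply: unary; exists u, v.
by apply: leq_trans (nu_measure_nseq _ _) _; rewrite leq_pmulr.
Qed.

Theorem theorem8 :
  exists C : nat, forall (T : choiceType) (w : seq T),
    nu_measure w <= C * minn (lsystem_measure w) (mac_measure w).
Proof.
exists 3 => T w; rewrite minnMr leq_min nu_measure_le_mac andbT.
by apply: leq_trans (nu_measure_le_lsystem w) _; rewrite leq_pmull.
Qed.
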